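(* The $\Delta$-topology on $\mathcal{N}$ and the $\Sigma\Delta$-topology on $\mathcal{N}$ are both Polish.
   Context: $\mathcal{N}=\omega^\omega$ is the Baire space. $\Sigma^1_1$, $\Pi^1_1$, $\Delta^1_1$ denote the lightface (effective, parameter-free) classes of subsets of $\mathcal{N}$. The $\Delta$-topology, denoted $\mathcal{S}_\Delta$, is the topology on $\mathcal{N}$ with basis the $\Delta^1_1$ subsets of $\mathcal{N}$. The $\Sigma\Delta$-topology is the topology on $\mathcal{N}$ with basis the $\Sigma^1_1$ subsets of $\mathcal{N}$ that are closed in $\mathcal{S}_\Delta$ (a set $A\subseteq\mathcal{N}$ is $\mathcal{S}_\Delta$-closed iff $A=\bigcap\{D\in\Delta^1_1 : D\supseteq A\}$). A topology is Polish if it is separable and completely metrizable. *)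

(* Defs.v *)
From HB Require Import structures.
From mathcomp Require Import all_boot all_order all_algebra.
From mathcomp Require Import all_classical all_reals.
From mathcomp Require Import topology.

Set Implicit Arguments.
Unset Strict Implicit.
Unset Printing Implicit Defensive.

Import Order.TTheory GRing.Theory Num.Theory.

Local Open Scope classical_set_scope.

Definition baire := nat -> nat.
HB.instance Definition _ := Pointed.on baire.

(* Arithmetical formulas: the first-order language of arithmetic with
   additional function variables, which are never quantified.  Number variables
   are de Bruijn indices, and [AApp j t] applies the [j]-th function variable
   to [t]. *)
Inductive aterm : Type :=
| AVar of nat
| AZero
| ASucc of aterm
| AAdd of aterm & aterm
| AMul of aterm & aterm
| AApp of nat & aterm.

Inductive aformula : Type :=
| AEq of aterm & aterm
| ANot of aformula
| AAnd of aformula & aformula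
| AAll of aformula.

Definition push (n : nat) (e : nat -> nat) (i : nat) : nat :=
  if i is j.+1 then e j else n.

Fixpoint aeval (f : nat -> baire) (e : nat -> nat) (t : aterm) : nat :=
  match t with
  | AVar i => e i
  | AZero => 0
  | ASucc t => (aeval f e t).+1
  | AAdd t u => aeval f e t + aeval f e u
  | AMul t u => aeval f e t * aeval f e u
  | AApp j t => f j (aeval f e t)
  end.

Fixpoint asat (f : nat -> baire) (e : nat -> nat) (p : aformula) : Prop :=
  match p with
  | AEq t u => aeval f e t = aeval f e u
  | ANot p => ~ asat f e p
  | AAnd p q => asat f e p /\ asat f e q
  | AAll p => forall n, asat f (push n e) p
  end.

(* [arith p x y]: p holds of (x, y), function variable 0 being interpreted by x
   and the others by y.  Free number variables denote 0, so that p has no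
   parameters. *)
Definition fenv (x y : baire) (j : nat) : baire := if j is 0 then x else y.

Definition arith (p : aformula) (x y : baire) : Prop :=
  asat (fenv x y) (fun=> 0) p.

Definition Sigma11 (A : set baire) : Prop :=
  exists p : aformula, A = [set x | exists y : baire, arith p x y].

Definition Pi11 (A : set baire) : Prop := Sigma11 (~` A).

Definition Delta11 (A : set baire) : Prop := Sigma11 A /\ Pi11 A.

Lemma Sigma11T : Sigma11 setT.
Proof.
exists (AEq AZero AZero); apply/seteqP; split=> // x _.
by exists (fun=> 0).
Qed.

Lemma Sigma110 : Sigma11 set0.
Proof.
by exists (ANot (AEq AZero AZero)); apply/seteqP; split=> // x [y /(_ erefl)].
Qed.

Lemma Sigma11U A B : Sigma11 A -> Sigma11 B -> Sigma11 (A `|` B).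
Proof.
move=> [p ->] [q ->]; exists (ANot (AAnd (ANot p) (ANot q))).
apply/seteqP; split=> x /=.
  by move=> [] [y h]; exists y => -[].
move=> [y /not_andP[] /contrapT h]; [left|right]; by exists y.
Qed.

(* Two witnesses are merged into one, along its even and odd places:
   [fshift k p] is p with y replaced by n |-> y (n + n + k). *)
Fixpoint tshift (k : nat) (t : aterm) : aterm :=
  match t with
  | AVar i => AVar i
  | AZero => AZero
  | ASucc t => ASucc (tshift k t)
  | AAdd t u => AAdd (tshift k t) (tshift k u)
  | AMul t u => AMul (tshift k t) (tshift k u)
  | AApp 0 t => AApp 0 (tshift k t)
  | AApp j.+1 t =>
      AApp j.+1 (AAdd (AAdd (tshift k t) (tshift k t)) (iter k ASucc AZero))
  end.

Fixpoint fshift (k : nat) (p : aformula) : aformula :=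
  match p with
  | AEq t u => AEq (tshift k t) (tshift k u)
  | ANot p => ANot (fshift k p)
  | AAnd p q => AAnd (fshift k p) (fshift k q)
  | AAll p => AAll (fshift k p)
  end.

Lemma aeval_tshift k x y e t :
  aeval (fenv x y) e (tshift k t) =
  aeval (fenv x (fun n => y (n + n + k))) e t.
Proof.
have numE : aeval (fenv x y) e (iter k ASucc AZero) = k.
  by elim: k => //= k ->.
elim: t => //= [t ->//|t -> u ->//|t -> u ->//|[|j] t IHt] /=.
  by rewrite IHt.
by rewrite IHt numE.
Qed.

Lemma asat_fshift k x y p e :
  asat (fenv x y) e (fshift k p) <->
  asat (fenv x (fun n => y (n + n + k))) e p.
Proof.
elim: p e => [t u|p IHp|p IHp q IHq|p IHp] e /=.
- by rewrite !aeval_tshift.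
- by rewrite IHp.
- by rewrite IHp IHq.
- by split=> h n; apply/IHp/h.
Qed.

Lemma Sigma11I A B : Sigma11 A -> Sigma11 B -> Sigma11 (A `&` B).
Proof.
move=> [p ->] [q ->]; exists (AAnd (fshift 0 p) (fshift 1 q)).
apply/seteqP; split=> x /=; last first.
  by move=> [y [/asat_fshift hp /asat_fshift hq]]; split; eexists; eassumption.
move=> [[y hp] [z hq]].
exists (fun n => if odd n then z n./2 else y n./2).
split; apply/asat_fshift.
  rewrite (_ : (fun n => _) = y)//; apply/funext => n.
  by rewrite addn0 addnn odd_double doubleK.
rewrite (_ : (fun n => _) = z)//; apply/funext => n.
by rewrite addn1 addnn /= odd_double uphalf_double.
Qed.

Lemma Delta11T : Delta11 setT.
Proof. by split; [exact: Sigma11T|rewrite /Pi11 setCT; exact: Sigma110]. Qed.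

Lemma Delta11I A B : Delta11 A -> Delta11 B -> Delta11 (A `&` B).
Proof.
move=> [sA pA] [sB pB]; split; first exact: Sigma11I.
by rewrite /Pi11 setCI; exact: Sigma11U.
Qed.

(* The Baire space carrying the topology with basis the Delta11 sets. *)
Definition delta_baire := baire.
HB.instance Definition _ := Pointed.on delta_baire.

Lemma delta_cover : \bigcup_(A in Delta11) (A : set delta_baire) = setT.
Proof. by apply/seteqP; split=> // x _; exists setT => //; exact: Delta11T. Qed.

Lemma delta_join (A B : set delta_baire) x :
  Delta11 A -> Delta11 B -> A x -> B x ->
  exists C, [/\ Delta11 C, C x & C `<=` A `&` B].
Proof.
by move=> dA dB Ax Bx; exists (A `&` B); split=> //; exact: Delta11I.
Qed.

HB.instance Definition _ :=
  isBaseTopological.Build delta_baire delta_cover delta_join.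

Definition SigmaDelta (A : set baire) : Prop :=
  Sigma11 A /\ closed (A : set delta_baire).

(* The Baire space carrying the topology with basis the SigmaDelta sets. *)
Definition sigma_delta_baire := baire.
HB.instance Definition _ := Pointed.on sigma_delta_baire.

Lemma sigma_delta_cover :
  \bigcup_(A in SigmaDelta) (A : set sigma_delta_baire) = setT.
Proof.
apply/seteqP; split=> // x _; exists setT => //.
by split; [exact: Sigma11T|exact: closedT].
Qed.

Lemma sigma_delta_join (A B : set sigma_delta_baire) x :
  SigmaDelta A -> SigmaDelta B -> A x -> B x ->
  exists C, [/\ SigmaDelta C, C x & C `<=` A `&` B].
Proof.
move=> [sA cA] [sB cB] Ax Bx; exists (A `&` B); split=> //.
by split; [exact: Sigma11I|exact: closedI].
Qed.

HB.instance Definition _ :=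
  isBaseTopological.Build sigma_delta_baire sigma_delta_cover sigma_delta_join.

Definition separable (T : topologicalType) : Prop :=
  exists2 S : set T, countable S & dense S.

Local Open Scope ring_scope.

Definition is_metric (R : realType) (T : Type) (d : T -> T -> R) : Prop :=
  [/\ forall x y, 0 <= d x y,
      forall x y, d x y = 0 <-> x = y,
      forall x y, d x y = d y x
    & forall x y z, d x z <= d x y + d y z].

Definition metric_induces (R : realType) (T : topologicalType)
    (d : T -> T -> R) : Prop :=
  forall A : set T,
    open A <->
    forall x, A x -> exists2 e : R, 0 < e & [set y | d x y < e] `<=` A.

Definition metric_complete (R : realType) (T : Type) (d : T -> T -> R) : Prop :=
  forall u : nat -> T,
    (forall e : R, 0 < e ->
       exists N, forall m n, (N <= m)%N -> (N <= n)%N -> d (u m) (u n) < e) ->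
    exists l : T, forall e : R, 0 < e ->
      exists N, forall n, (N <= n)%N -> d (u n) l < e.

Definition completely_metrizable (R : realType) (T : topologicalType) : Prop :=
  exists d : T -> T -> R,
    [/\ is_metric d, metric_induces d & metric_complete d].

Definition polish (R : realType) (T : topologicalType) : Prop :=
  separable T /\ completely_metrizable R T.

(* Main.v *)
Require Import Defs.
From mathcomp Require Import all_boot all_order all_algebra.
From mathcomp Require Import all_classical all_reals.
From mathcomp Require Import topology.
From mathcomp Require Import zify.

(* A Delta11 set D and its complement are projections of effectively closed
   sets, so membership in D is decided by a clopen game: player 0 builds a
   witness for x in D, player 1 a witness for the opposite, and whoever first
   leaves the tree of his closed set loses.  The function G x recording at each
   position a least winning move is the only solution of rules which are
   arithmetical and closed in (x, G x).  Hence {x | G x n = k} is Delta11 and G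
   has a closed graph, without any boundedness or hyperarithmetic theory.  The
   map sending x to x together with all the G x, for D ranging over the
   countably many Delta11 sets, is then an embedding of the Delta-topology onto
   a closed subset of a countable power of the natural numbers.  For the
   SigmaDelta-topology one adds for each basic set A the function with value 0
   on A and n + 1 at x outside A, where n is least such that the n-th Delta11
   set contains x and is disjoint from A. *)

Set Implicit Arguments.
Unset Strict Implicit.
Unset Printing Implicit Defensive.

Import Order.TTheory GRing.Theory Num.Theory.

Local Open Scope classical_set_scope.

(** * Arithmetical definability and Skolem normal form *)

(** Injective because [qpair a b] lies between the squares of [a + b] and [a + b + 1], so the sum
    can be read off. Being a polynomial, it is a term of arithmetic. *)
Definition qpair (a b : nat) : nat := (a + b) * (a + b) + a.

Lemma qpair_inj a b c d : qpair a b = qpair c d -> a = c /\ b = d.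
Proof.
rewrite /qpair => h.
have : a + b = c + d by nia.
by move=> hs; rewrite hs in h; lia.
Qed.

Lemma qpair_geL a b : a <= qpair a b.
Proof. by rewrite /qpair leq_addl. Qed.

Lemma qpair_uncurry (F : nat -> nat -> nat) :
  exists f : nat -> nat, forall a b, f (qpair a b) = F a b.
Proof.
have /choice[f hf] n : exists v, forall a b, n = qpair a b -> v = F a b.
  have [[[a b] ->]|h] := pselect (exists ab, n = qpair ab.1 ab.2).
    by exists (F a b) => c d /= /qpair_inj[-> ->].
  by exists 0 => a b e; case: h; exists (a, b).
by exists f => a b; exact: hf.
Qed.

(** Definability is a property of functions and predicates of the environments, so that closure
    lemmas take the place of explicit syntax. *)
Definition definable_term (t : (nat -> baire) -> (nat -> nat) -> nat) : Prop :=
  exists u, forall f e, aeval f e u = t f e.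

Definition definable (P : (nat -> baire) -> (nat -> nat) -> Prop) : Prop :=
  exists p, forall f e, asat f e p <-> P f e.

Lemma dt_var i : definable_term (fun f e => e i).
Proof. by exists (AVar i). Qed.

Lemma dt_const k : definable_term (fun f e => k).
Proof. by exists (iter k ASucc AZero) => f e; elim: k => //= k ->. Qed.

Lemma dt_succ t : definable_term t -> definable_term (fun f e => (t f e).+1).
Proof. by case=> u hu; exists (ASucc u) => f e /=; rewrite hu. Qed.

Lemma dt_add t t' : definable_term t -> definable_term t' ->
  definable_term (fun f e => t f e + t' f e).
Proof. by move=> [u hu] [v hv]; exists (AAdd u v) => f e /=; rewrite hu hv. Qed.

Lemma dt_mul t t' : definable_term t -> definable_term t' ->
  definable_term (fun f e => t f e * t' f e).
Proof. by move=> [u hu] [v hv]; exists (AMul u v) => f e /=; rewrite hu hv. Qed.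

Lemma dt_app j t : definable_term t -> definable_term (fun f e => f j (t f e)).
Proof. by move=> [u hu]; exists (AApp j u) => f e /=; rewrite hu. Qed.

Lemma dt_pair t t' : definable_term t -> definable_term t' ->
  definable_term (fun f e => qpair (t f e) (t' f e)).
Proof. by move=> ht ht'; apply: dt_add => //; apply: dt_mul; apply: dt_add. Qed.

Lemma dt_subst t (s : (nat -> baire) -> (nat -> nat) -> nat -> nat) :
  definable_term t -> (forall i, definable_term (fun f e => s f e i)) ->
  definable_term (fun f e => t f (s f e)).
Proof.
move=> [u hu] hs.
suff [v hv] : definable_term (fun f e => aeval f (s f e) u).
  by exists v => f e; rewrite hv hu.
elim: u {t hu} => [i||u IHu|u IHu v IHv|u IHu v IHv|j u IHu] /=.
- exact: hs.
- exact: dt_const.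
- exact: dt_succ.
- exact: dt_add.
- exact: dt_mul.
- exact: dt_app.
Qed.

Lemma dt_weaken t : definable_term t ->
  definable_term (fun f e => t f (fun i => e i.+1)).
Proof. by move=> ht; apply: dt_subst ht _ => i; exact: dt_var. Qed.

Lemma d_ext P Q : (forall f e, P f e <-> Q f e) -> definable P -> definable Q.
Proof. by move=> h [p hp]; exists p => f e; rewrite hp. Qed.

Lemma d_eq t t' : definable_term t -> definable_term t' ->
  definable (fun f e => t f e = t' f e).
Proof. by move=> [u hu] [v hv]; exists (AEq u v) => f e /=; rewrite hu hv. Qed.

Lemma d_not P : definable P -> definable (fun f e => ~ P f e).
Proof. by move=> [p hp]; exists (ANot p) => f e /=; rewrite hp. Qed.

Lemma d_and P Q : definable P -> definable Q ->
  definable (fun f e => P f e /\ Q f e).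
Proof. by move=> [p hp] [q hq]; exists (AAnd p q) => f e /=; rewrite hp hq. Qed.

Lemma d_all (P : nat -> (nat -> baire) -> (nat -> nat) -> Prop) :
  definable (fun f e => P (e 0) f (fun i => e i.+1)) ->
  definable (fun f e => forall n, P n f e).
Proof.
move=> [p hp]; exists (AAll p) => f e /=.
by split=> h n; [have /hp := h n|apply/hp; exact: h].
Qed.

Lemma d_imp P Q : definable P -> definable Q ->
  definable (fun f e => P f e -> Q f e).
Proof.
move=> dP dQ; apply: d_ext (d_not (d_and dP (d_not dQ))) => f e.
split; first by move=> /not_andP[//|/contrapT].
by move=> h [/h].
Qed.

Lemma d_or P Q : definable P -> definable Q ->
  definable (fun f e => P f e \/ Q f e).
Proof.
move=> dP dQ; apply: d_ext (d_not (d_and (d_not dP) (d_not dQ))) => f e.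
split; first by move=> /not_andP[] /contrapT; [left|right].
by move=> [h|h] [].
Qed.

Lemma d_ex (P : nat -> (nat -> baire) -> (nat -> nat) -> Prop) :
  definable (fun f e => P (e 0) f (fun i => e i.+1)) ->
  definable (fun f e => exists n, P n f e).
Proof.
move=> dP.
have := d_not (@d_all (fun n f e => ~ P n f e) (d_not dP)).
apply: d_ext => f e; split; last by move=> [n ?] /(_ n).
by move=> /existsNP[n /contrapT]; exists n.
Qed.

Lemma d_lt t t' : definable_term t -> definable_term t' ->
  definable (fun f e => t f e < t' f e).
Proof.
move=> dt dt'.
apply: (@d_ext (fun f e => exists n, (t f e + n).+1 = t' f e)).
  move=> f e; split=> [[n <-]|h]; first by rewrite ltnS leq_addr.
  by exists (t' f e - (t f e).+1); rewrite -addSn subnKC.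
apply: (@d_ex (fun n f e => (t f e + n).+1 = t' f e)); apply: d_eq.
  by apply: dt_succ; apply: dt_add; [exact: dt_weaken|exact: dt_var].
exact: dt_weaken.
Qed.

Lemma d_odd t : definable_term t -> definable (fun f e => odd (t f e)).
Proof.
move=> dt; apply: (@d_ext (fun f e => exists n, (n + n).+1 = t f e)).
  move=> f e; split=> [[n <-]|h]; first by rewrite addnn /= odd_double.
  by exists (t f e)./2; rewrite addnn -[RHS]odd_double_half h.
apply: (@d_ex (fun n f e => (n + n).+1 = t f e)); apply: d_eq.
  by apply: dt_succ; apply: dt_add; exact: dt_var.
exact: dt_weaken.
Qed.

Lemma Sigma11_definable (P : baire -> baire -> Prop) :
  definable (fun f e => P (f 0) (f 1)) -> Sigma11 [set x | exists y, P x y].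
Proof.
move=> [p hp]; exists p; apply/seteqP.
by split=> x [y] h; exists y; apply/(hp (fenv x y) (fun=> 0)).
Qed.

(** Negation normal form without existential number quantifiers: what remains of an arithmetical
    formula once Skolem functions are supplied. Such formulas are closed conditions on the
    functions, by [uapprox_usat]. *)
Inductive uformula : Type :=
| ULit of bool & aterm & aterm
| UAnd of uformula & uformula
| UOr of uformula & uformula
| UAll of uformula.

Fixpoint usat (f : nat -> baire) (e : nat -> nat) (q : uformula) : Prop :=
  match q with
  | ULit b t u => (aeval f e t == aeval f e u) = b
  | UAnd q r => usat f e q /\ usat f e r
  | UOr q r => usat f e q \/ usat f e r
  | UAll q => forall n, usat f (push n e) q
  end.

(* A simultaneous substitution: [F f e j] is put for the [j]-th function
   variable and [s f e i] for the [i]-th number variable. *)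
Definition definable_subst
    (F : (nat -> baire) -> (nat -> nat) -> nat -> baire)
    (s : (nat -> baire) -> (nat -> nat) -> nat -> nat) : Prop :=
  (forall j, definable_term (fun f e => F f (fun i => e i.+1) j (e 0))) /\
  (forall i, definable_term (fun f e => s f e i)).

Lemma definable_subst_push F s : definable_subst F s ->
  definable_subst (fun f e => F f (fun i => e i.+1))
                  (fun f e => push (e 0) (s f (fun i => e i.+1))).
Proof.
move=> [hF hs]; split=> [j|[|i] /=]; last 2 first.
- exact: dt_var.
- exact: (dt_weaken (hs i)).
(* Index 0 remains the argument of the substituted function; index 1, the newly bound number, is
   skipped. *)
by apply: (dt_subst (s := fun f e i => if i is i'.+1 then e i'.+2 else e 0))
  (hF j) _ => -[|i]; exact: dt_var.
Qed.

Lemma dt_aeval F s t : definable_subst F s ->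
  definable_term (fun f e => aeval (F f e) (s f e) t).
Proof.
move=> [hF hs].
elim: t => [i||t IHt|t IHt u IHu|t IHt u IHu|j t IHt] /=.
- exact: hs.
- exact: dt_const.
- exact: dt_succ.
- exact: dt_add.
- exact: dt_mul.
- apply: (dt_subst (s := fun f e => push (aeval (F f e) (s f e) t) e)) (hF j) _.
  by case=> [//|i]; exact: dt_var.
Qed.

Lemma usat_subst F s q : definable_subst F s ->
  exists r, forall f e, usat f e r <-> usat (F f e) (s f e) q.
Proof.
elim: q F s => [b t u|q IHq r IHr|q IHq r IHr|q IHq] F s hFs /=.
- have [[t' ht] [u' hu]] := (dt_aeval t hFs, dt_aeval u hFs).
  by exists (ULit b t' u') => f e /=; rewrite ht hu.
- have [[q' hq] [r' hr]] := (IHq _ _ hFs, IHr _ _ hFs).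
  by exists (UAnd q' r') => f e /=; rewrite hq hr.
- have [[q' hq] [r' hr]] := (IHq _ _ hFs, IHr _ _ hFs).
  by exists (UOr q' r') => f e /=; rewrite hq hr.
- have [q' hq] := IHq _ _ (definable_subst_push hFs).
  exists (UAll q') => f e /=.
  by split=> h n; [have /hq := h n|apply/hq; exact: h].
Qed.

Definition fcons (w : baire) (f : nat -> baire) (j : nat) : baire :=
  if j is j'.+1 then f j' else w.

(** A single function, put in front as variable 0, carries all the Skolem functions; the closure
    lemmas below pack several functions into one. *)
Definition skolem_form (P : (nat -> baire) -> (nat -> nat) -> Prop) : Prop :=
  exists q, forall f e, P f e <-> exists w, usat (fcons w f) e q.

Lemma sk_ext P Q : (forall f e, P f e <-> Q f e) ->
  skolem_form P -> skolem_form Q.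
Proof. by move=> h [p hp]; exists p => f e; rewrite -h. Qed.

Lemma sk_lit b t u :
  skolem_form (fun f e => (aeval f e t == aeval f e u) = b).
Proof.
have hS : definable_subst (fun f e j => f j.+1) (fun f e => e).
  by split=> i; [apply: dt_app|]; exact: dt_var.
have [q hq] := usat_subst (ULit b t u) hS.
exists q => f e; split=> [h|[w /hq//]].
by exists (fun=> 0); apply/hq.
Qed.

Lemma double_merge (a b : baire) : exists w : baire,
  (fun n => w (n + n + 0)) = a /\ (fun n => w (n + n + 1)) = b.
Proof.
exists (fun n => if odd n then b n./2 else a n./2).
split; apply/funext => n.
  by rewrite addn0 addnn odd_double doubleK.
by rewrite addn1 addnn /= odd_double uphalf_double.
Qed.

Lemma sk_and P Q : skolem_form P -> skolem_form Q ->
  skolem_form (fun f e => P f e /\ Q f e).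
Proof.
move=> [p hp] [q hq].
have hS k : definable_subst
    (fun f e j => if j is j'.+1 then f j else fun n => f 0 (n + n + k))
    (fun f e => e).
  split=> [[|j]|i]; last exact: dt_var; last exact/dt_app/dt_var.
  by apply/dt_app/dt_add; [apply: dt_add; exact: dt_var|exact: dt_const].
have [[p' hp'] [q' hq']] := (usat_subst p (hS 0), usat_subst q (hS 1)).
have fE k w f : (fun j => if j is j'.+1 then fcons w f j
    else fun n => fcons w f 0 (n + n + k)) = fcons (fun n => w (n + n + k)) f.
  by apply/funext => -[].
exists (UAnd p' q') => f e; rewrite hp hq; split=> /=.
  move=> [[a ha] [b hb]]; have [w [wa wb]] := double_merge a b.
  by exists w; rewrite hp' hq' !fE wa wb.
move=> [w]; rewrite hp' hq' !fE => -[ha hb].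
by split; [exists (fun n => w (n + n + 0))|exists (fun n => w (n + n + 1))].
Qed.

Lemma sk_or P Q : skolem_form P -> skolem_form Q ->
  skolem_form (fun f e => P f e \/ Q f e).
Proof.
move=> [p hp] [q hq]; exists (UOr p q) => f e; rewrite hp hq; split=> /=.
  by move=> [[w h]|[w h]]; exists w; [left|right].
by move=> [w [h|h]]; [left|right]; exists w.
Qed.

(** The functions chosen for the various [n] are glued along [qpair]: the [n]-th section of [w]
    serves the instance [n]. *)
Lemma sk_all P : skolem_form P ->
  skolem_form (fun f e => forall n, P f (push n e)).
Proof.
move=> [p hp].
have hS : definable_subst
    (fun f e j => if j is j'.+1 then f j else fun n => f 0 (qpair (e 0) n))
    (fun f e => e).
  split=> [[|j]|i]; last exact: dt_var; last exact/dt_app/dt_var.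
  by apply/dt_app/dt_pair; exact: dt_var.
have [q hq] := usat_subst p hS.
have fE w f k : (fun j => if j is j'.+1 then fcons w f j
    else fun n => fcons w f 0 (qpair k n)) = fcons (fun n => w (qpair k n)) f.
  by apply/funext => -[].
exists (UAll q) => f e; split=> /= [h|[w h] n]; last first.
  by apply/hp; exists (fun m => w (qpair n m)); have /hq /= := h n; rewrite fE.
have [W hW] := choice (fun n => (hp f (push n e)).1 (h n)).
have [w hw] := qpair_uncurry W; exists w => n; apply/hq; rewrite /= fE.
by rewrite (_ : (fun m => _) = W n)//; apply/funext => m; exact: hw.
Qed.

(** The number is stored as [w 0], and the Skolem function of the body in the later values of
    [w]. *)
Lemma sk_ex P : skolem_form P ->
  skolem_form (fun f e => exists n, P f (push n e)).
Proof.
move=> [p hp].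
have hS : definable_subst
    (fun f e j => if j is j'.+1 then f j else fun n => f 0 n.+1)
    (fun f e => push (f 0 0) e).
  split=> [[|j]|[|i]] /=; last exact: dt_var.
  - exact/dt_app/dt_succ/dt_var.
  - exact/dt_app/dt_var.
  - exact/dt_app/dt_const.
have [q hq] := usat_subst p hS.
have fE w f : (fun j => if j is j'.+1 then fcons w f j
    else fun n => fcons w f 0 n.+1) = fcons (fun n => w n.+1) f.
  by apply/funext => -[].
exists q => f e; split=> [[n /hp[w hw]]|[w /hq]]; rewrite /=.
  exists (fun m => if m is m'.+1 then w m' else n); apply/hq.
  by rewrite fE.
by rewrite fE => h; exists (w 0); apply/hp; exists (fun n => w n.+1).
Qed.

(** The induction carries the negation along, because in [uformula] only literals have a sign. *)
Lemma skolem_normal_form p :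
  skolem_form (fun f e => asat f e p) /\ skolem_form (fun f e => ~ asat f e p).
Proof.
elim: p => [t u|p [IHp IHNp]|p [IHp IHNp] q [IHq IHNq]|p [IHp IHNp]] /=.
- split; [apply: sk_ext (sk_lit true t u)|apply: sk_ext (sk_lit false t u)].
    by move=> f e; split=> /eqP.
  by move=> f e; case: eqP.
- by split=> //; apply: sk_ext IHp => f e; split=> [?|/contrapT].
- split; first exact: (sk_and IHp IHq).
  by apply: sk_ext (sk_or IHNp IHNq) => f e; split=> /not_andP.
- split; first exact: (sk_all IHp).
  by apply: sk_ext (sk_ex IHNp) => f e; split=> /existsNP.
Qed.

(* The witness is read off the even or the odd places of [a], so that two such
   representations can share one function variable. *)
Lemma Sigma11_closed (A : set baire) (k : nat) : Sigma11 A ->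
  exists q (C : baire -> baire -> Prop), A = [set x | exists w, C x w] /\
  forall x a, usat (fenv x a) (fun=> 0) q <-> C x (fun n => a (n + n + k)).
Proof.
move=> [p Ap]; have [[q hq] _] := skolem_normal_form p.
(* The even places hold the Skolem function, the odd places the original witness. *)
pose split0 x (w : baire) (j : nat) : baire :=
  if j is j'.+1 then fenv x (fun n => w (n + n + 1)) j'
  else fun n => w (n + n + 0).
have hS : definable_subst (fun f e => split0 (f 0) (fun n => f 1 (n + n + k)))
    (fun f e i => 0).
  by rewrite /split0; split=> [[|[|j]]|i] /=; repeat first
    [exact: dt_var|exact: dt_const|apply: dt_app|apply: dt_add].
have [r hr] := usat_subst q hS.
exists r, (fun x w => usat (split0 x w) (fun=> 0) q); split; last first.
  by move=> x a; rewrite hr.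
rewrite Ap; apply/seteqP; split=> x [y].
  move=> /hq[v hv]; have [w [wv wy]] := double_merge v y.
  exists w; suff -> : split0 x w = fcons v (fenv x y) by [].
  by apply/funext => -[|[|j]]; rewrite /split0 /= ?wv ?wy.
move=> h; exists (fun n => y (n + n + 1)); apply/hq.
exists (fun n => y (n + n + 0)).
suff <- : split0 x y = fcons (fun n => y (n + n + 0))
  (fenv x (fun n => y (n + n + 1))) by [].
by apply/funext => -[|[|j]].
Qed.

(** * Finite approximations *)

(** Bounding the arguments of function variables is enough to make the value of the term depend only
    on their restrictions below [m]. *)
Fixpoint term_bounded (m : nat) (f : nat -> baire) (e : nat -> nat) (t : aterm)
    : bool :=
  match t with
  | AVar _ | AZero => true
  | ASucc t => term_bounded m f e t
  | AAdd t u | AMul t u => term_bounded m f e t && term_bounded m f e u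
  | AApp j t => term_bounded m f e t && (aeval f e t < m)
  end.

(* The [m]-th approximation of [usat], which only looks at the values of the
   functions below [m]. *)
Fixpoint uapprox (m : nat) (f : nat -> baire) (e : nat -> nat) (q : uformula)
    : Prop :=
  match q with
  | ULit b t u => term_bounded m f e t -> term_bounded m f e u ->
      (aeval f e t == aeval f e u) = b
  | UAnd q r => uapprox m f e q /\ uapprox m f e r
  | UOr q r => uapprox m f e q \/ uapprox m f e r
  | UAll q => forall n, n < m -> uapprox m f (push n e) q
  end.

Lemma term_bounded_mono m m' f e t : m <= m' ->
  term_bounded m f e t -> term_bounded m' f e t.
Proof.
move=> mm'; elim: t => //= [t IHt u IHu|t IHt u IHu|j t IHt] /andP[h h'].
- by rewrite IHt ?IHu.
- by rewrite IHt ?IHu.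
- by rewrite IHt //= (leq_trans h').
Qed.

Lemma term_bounded_ex f e t : exists m, term_bounded m f e t.
Proof.
elim: t => /= [n||t //|t [m hm] u [m' hm']|t [m hm] u [m' hm']|j t [m hm]].
- by exists 0.
- by exists 0.
- by exists (maxn m m'); rewrite (term_bounded_mono _ hm) ?leq_maxl//
    (term_bounded_mono _ hm') ?leq_maxr.
- by exists (maxn m m'); rewrite (term_bounded_mono _ hm) ?leq_maxl//
    (term_bounded_mono _ hm') ?leq_maxr.
- by exists (maxn m (aeval f e t).+1); rewrite (term_bounded_mono _ hm)
    ?leq_maxl//= leq_maxr.
Qed.

Lemma term_bounded_ext m f g e t :
  (forall j n, n < m -> f j n = g j n) -> term_bounded m f e t ->
  aeval f e t = aeval g e t /\ term_bounded m g e t.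
Proof.
move=> fg; elim: t => //= [t IHt|t IHt u IHu|t IHt u IHu|j t IHt].
- by move=> /IHt[-> ->].
- by move=> /andP[/IHt[-> ->] /IHu[-> ->]].
- by move=> /andP[/IHt[-> ->] /IHu[-> ->]].
- by move=> /andP[/IHt[-> ->] h]; rewrite fg.
Qed.

Lemma uapprox_mono m m' f e q : m <= m' ->
  uapprox m' f e q -> uapprox m f e q.
Proof.
move=> mm'; elim: q e => [b t u|q IHq r IHr|q IHq r IHr|q IHq] e /=.
- by move=> h ht hu; apply: h; exact: term_bounded_mono mm' _.
- by move=> [/IHq ? /IHr].
- by move=> [/IHq|/IHr]; [left|right].
- by move=> h n nm; apply: IHq; apply: h; exact: leq_trans mm'.
Qed.

Lemma uapprox_ext m f g e q : (forall j n, n < m -> f j n = g j n) ->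
  uapprox m f e q -> uapprox m g e q.
Proof.
move=> fg; have gf j n : n < m -> g j n = f j n by move=> ?; rewrite fg.
elim: q e => [b t u|q IHq r IHr|q IHq r IHr|q IHq] e /=.
- by move=> h /(term_bounded_ext gf)[-> /h{}h] /(term_bounded_ext gf)[-> /h].
- by move=> [/IHq ? /IHr].
- by move=> [/IHq|/IHr]; [left|right].
- by move=> h n nm; apply: IHq; exact: h.
Qed.

Lemma usat_uapprox m f e q : usat f e q -> uapprox m f e q.
Proof.
elim: q e => [b t u|q IHq r IHr|q IHq r IHr|q IHq] e //=.
- by move=> [/IHq ? /IHr].
- by move=> [/IHq|/IHr]; [left|right].
- by move=> h n nm; apply: IHq; exact: h.
Qed.

(** The approximations decrease with [m], so two disjuncts refuted at different stages are both
    refuted at the larger stage. An existential number quantifier, an infinite disjunction, would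
    break this argument. *)
Lemma uapprox_usat f e q : (forall m, uapprox m f e q) -> usat f e q.
Proof.
elim: q e => [b t u|q IHq r IHr|q IHq r IHr|q IHq] e /= h.
- have [[m hm] [m' hm']] := (term_bounded_ex f e t, term_bounded_ex f e u).
  apply: (h (maxn m m')).
    by rewrite (term_bounded_mono _ hm) ?leq_maxl.
  by rewrite (term_bounded_mono _ hm') ?leq_maxr.
- by split; [apply: IHq|apply: IHr] => m; have [] := h m.
- apply: contrapT => /not_orP[hq hr].
  have [m hm] : exists m, ~ uapprox m f e q.
    by apply: contrapT => /forallNP/= h'; apply/hq/IHq => m; exact: contrapT.
  have [m' hm'] : exists m, ~ uapprox m f e r.
    by apply: contrapT => /forallNP/= h'; apply/hr/IHr => k; exact: contrapT.
  have [/(uapprox_mono (leq_maxl _ _))|/(uapprox_mono (leq_maxr _ _))] //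
    := h (maxn m m').
(* The instance [n] is tested only at stages above [n]. *)
- by move=> n; apply: IHq => m; apply: (@uapprox_mono _ (maxn m n.+1));
    [exact: leq_maxl|apply: h; exact: leq_maxr].
Qed.

Lemma d_term_bounded m F s t : definable_term m -> definable_subst F s ->
  definable (fun f e => term_bounded (m f e) (F f e) (s f e) t).
Proof.
move=> dm hFs; have dT : definable (fun _ _ => true).
  exact: (@d_ext (fun _ _ => 0 = 0)) (d_eq (dt_const _) (dt_const _)).
have dA P Q : definable (fun f e => is_true (P f e)) ->
    definable (fun f e => is_true (Q f e)) ->
    definable (fun f e => P f e && Q f e).
  by move=> dP dQ; apply: d_ext (d_and dP dQ) => f e; split=> /andP.
elim: t => //= [t ? u ?|t ? u ?|j t ?]; apply: (dA) => //.
by apply: d_lt => //; exact: dt_aeval.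
Qed.

Lemma d_uapprox m F s q : definable_term m -> definable_subst F s ->
  definable (fun f e => uapprox (m f e) (F f e) (s f e) q).
Proof.
elim: q m F s => [b t u|q IHq r IHr|q IHq r IHr|q IHq] m F s dm hFs /=.
- apply: d_imp; first exact: d_term_bounded.
  apply: d_imp; first exact: d_term_bounded.
  have d := d_eq (dt_aeval t hFs) (dt_aeval u hFs).
  case: b; first by apply: d_ext d => f e; case: eqP.
  by apply: d_ext (d_not d) => f e; case: eqP.
- by apply: d_and; [exact: IHq|exact: IHr].
- by apply: d_or; [exact: IHq|exact: IHr].
- apply: (@d_all (fun n f e =>
    n < m f e -> uapprox (m f e) (F f e) (push n (s f e)) q)).
  apply: d_imp; first by apply: d_lt; [exact: dt_var|exact: dt_weaken].
  by apply: IHq (definable_subst_push hFs); exact: dt_weaken.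
Qed.

(** * Well-founded games on numbers *)

(* Positions of the game: [ext c i] is the position reached from [c] by the
   move [i].  Every number is a position; those that are neither [0] nor an
   [ext c i] are further initial positions. *)
Definition ext (c i : nat) : nat := (qpair c i).+1.

Lemma ext_inj c i d j : ext c i = ext d j -> c = d /\ i = j.
Proof. by move=> [/qpair_inj]. Qed.

Lemma dec_exists : exists dec : nat -> seq nat,
  (forall c i, dec (ext c i) = rcons (dec c) i) /\
  (forall d, (forall c i, d <> ext c i) -> dec d = [::]).
Proof.
have /choice[un hun] d : exists o : option (nat * nat),
    if o is Some (c, i) then d = ext c i else forall c i, d <> ext c i.
  have [[[c i] ->]|h] := pselect (exists ci, d = ext ci.1 ci.2).
    by exists (Some (c, i)).
  by exists None => c i e; apply: h; exists (c, i).
(* The first argument is fuel; [d.+1] suffices because [c < ext c i]. *)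
pose decf := fix decf n d {struct n} : seq nat := if n is n'.+1 then
  if un d is Some (c, i) then rcons (decf n' c) i else [::] else [::].
have unext c i : un (ext c i) = Some (c, i).
  have := hun (ext c i); case: (un _) => [[d j] /ext_inj[-> ->]//|].
  by move=> /(_ c i).
have decf_fuel n m d : d < n -> d < m -> decf n d = decf m d.
  elim: n m d => [|n IHn] [|m] d //= dn dm.
  have := hun d; case: (un d) => [[c i] dE|//]; rewrite (IHn m)//.
  - by move: dn; rewrite dE ltnS; apply: leq_trans; rewrite ltnS qpair_geL.
  - by move: dm; rewrite dE ltnS; apply: leq_trans; rewrite ltnS qpair_geL.
exists (fun d => decf d.+1 d); split=> [c i|d h].
  transitivity (rcons (decf (ext c i) c) i); first by rewrite /= unext.
  by congr rcons; apply: decf_fuel => //; rewrite ltnS qpair_geL.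
by rewrite /=; have := hun d; case: (un d) => // -[c i] /h.
Qed.

Definition dec : nat -> seq nat := sval (cid dec_exists).

Lemma dec_ext c i : dec (ext c i) = rcons (dec c) i.
Proof. by have [] := svalP (cid dec_exists). Qed.

Lemma dec_root d : (forall c i, d <> ext c i) -> dec d = [::].
Proof. by have [_] := svalP (cid dec_exists); exact. Qed.

Section Game.
(* [own c] and [opp c]: the player to move at [c], resp. his opponent, still
   obeys his rules at [c]. *)
Variables own opp : nat -> Prop.

(* [g c] is [0] if the player to move at [c] loses, and otherwise [i.+1] for
   his least winning move [i].  Each clause is decided by finitely many values
   of [g], or is an infinite conjunction of such conditions: this is why the
   least winning moves are recorded. *)
Definition game_value (g : nat -> nat) : Prop := forall c,
  (~ own c -> g c = 0) /\ (own c -> ~ opp c -> g c = 1) /\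
  (own c -> opp c -> (g c = 0 -> forall i, g (ext c i) <> 0) /\
    (forall i, g c = i.+1 ->
      g (ext c i) = 0 /\ (forall j, j < i -> g (ext c j) <> 0))).

(** The boolean tells whether the player to move wins. His own rules are tested first, so he loses
    when both players have broken theirs; this keeps the outcome unique. *)
Inductive outcome : nat -> bool -> Prop :=
| LostNow c : ~ own c -> outcome c false
| WonNow c : own c -> ~ opp c -> outcome c true
| Wins c i : own c -> opp c -> outcome (ext c i) false -> outcome c true
| Loses c : own c -> opp c -> (forall i, outcome (ext c i) true) ->
    outcome c false.

Lemma outcome_fun c b b' : outcome c b -> outcome c b' -> b = b'.
Proof.
move=> h; elim: h b' => {c b} [c nc|c oc nc|c i oc pc _ IH|c oc pc _ IH] b' h';
  inversion h'; subst => //.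
- by have := IH _ (H1 i).
- by have := IH i _ H1.
Qed.

Lemma game_value_outcome g c b : game_value g -> outcome c b ->
  (g c == 0) = ~~ b.
Proof.
move=> hg; elim=> {c b} [c nc|c oc nc|c i oc pc _ IH|c oc pc _ IH];
  have [h1 [h2 h3]] := hg c.
- by rewrite h1.
- by rewrite h2.
- have [h4 _] := h3 oc pc; case: eqP => // /h4/(_ i)[].
  by apply/eqP; rewrite IH.
- have [_ h4] := h3 oc pc; case: (g c) h4 => // i /(_ _ erefl)[h5 _].
  by have := IH i; rewrite h5.
Qed.

Hypothesis wf : forall s : nat -> nat,
  (forall n, exists i, s n.+1 = ext (s n) i) ->
  exists n, ~ (own (s n) /\ opp (s n)).

(** At a position without outcome both players are alive and some successor again has no outcome.
    Iterating a choice of such successors gives an infinite play that [wf] forbids. *)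
Lemma outcome_total c : exists b, outcome c b.
Proof.
apply: contrapT => hc.
have /choice[F hF] d : exists d', ~ (exists b, outcome d b) ->
    [/\ own d /\ opp d, exists i, d' = ext d i & ~ exists b, outcome d' b].
  have [|nd] := pselect (exists b, outcome d b); first by exists 0.
  have [od|od] := pselect (own d); last first.
    by case: nd; exists false; exact: LostNow.
  have [pd|pd] := pselect (opp d); last by case: nd; exists true; exact: WonNow.
  have [[i hi]|h] := pselect (exists i, ~ exists b, outcome (ext d i) b).
    by exists (ext d i) => _; split=> //; exists i.
  case: nd; have [[i hi]|h'] := pselect (exists i, outcome (ext d i) false).
    by exists true; exact: Wins hi.
  exists false; apply: Loses => // i.
  have /contrapT[[//|hb]] : ~ ~ exists b, outcome (ext d i) b.
    by move=> ?; apply: h; exists i.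
  by case: h'; exists i.
have undec n : ~ exists b, outcome (iter n F c) b.
  by elim: n => //= n /hF[].
have [n|n] := wf (s := fun n => iter n F c); first by have [] := hF _ (undec n).
by have [] := hF _ (undec n).
Qed.

Lemma game_value_ex : exists g, game_value g.
Proof.
have dich c : ~ outcome c true -> outcome c false.
  by have [[]] := outcome_total c.
have excl c : outcome c true -> ~ outcome c false.
  by move=> h h'; have := outcome_fun h h'.
have /choice[g hg] c : exists v, [/\ ~ outcome c true -> v = 0,
    outcome c true -> ~ opp c -> v = 1 &
    outcome c true -> opp c -> exists i, [/\ v = i.+1, outcome (ext c i) false
      & forall j, j < i -> ~ outcome (ext c j) false]].
  have [ct|ct] := pselect (outcome c true); last by exists 0.
  have [oc|oc] := pselect (opp c); last by exists 1.
  have hex : exists i, `[< outcome (ext c i) false >].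
    by inversion ct; subst => //; exists i; apply/asboolP.
  have [k /asboolP hk mk] := ex_minnP hex.
  exists k.+1; split=> // _ _; exists k; split=> // j jk /asboolP/mk.
  by rewrite leqNgt jk.
have g0 c : g c = 0 -> ~ outcome c true.
  move=> gc ct; have [_ h1 h2] := hg c.
  have [/(h2 ct)[i []]|/(h1 ct)] := pselect (opp c); by rewrite gc.
exists g => c; have [h1 h2 h3] := hg c; split; [|split].
- by move=> nc; apply: h1 => ct; inversion ct; subst.
- by move=> oc nc; apply: h2 => //; exact: WonNow.
- move=> oc pc; split=> [gc i gi|i gi].
    by apply: (g0 _ gc); apply: Wins oc pc (dich _ (g0 _ gi)).
  have ct : outcome c true.
    by apply: contrapT => /h1; rewrite gi.
  have [k [gk hk mk]] := h3 ct pc; move: gk; rewrite gi => -[ik]; subst k.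
  split=> [|j /mk hj gj]; last by apply: hj; exact/dich/g0.
  by have [h _ _] := hg (ext c i); apply: h => /excl.
Qed.

(** The zeros of a solution are determined by the outcomes; a nonzero value is then determined by
    the minimality of the recorded move. *)
Lemma game_value_unique g g' : game_value g -> game_value g' -> g = g'.
Proof.
move=> hg hg'; apply/funext => c.
have g0 d : (g d == 0) = (g' d == 0).
  have [b db] := outcome_total d.
  by rewrite (game_value_outcome hg db) (game_value_outcome hg' db).
have [h1 [h2 h3]] := hg c; have [h1' [h2' h3']] := hg' c.
have [oc|oc] := pselect (own c); last by rewrite h1 ?h1'.
have [pc|pc] := pselect (opp c); last by rewrite h2 ?h2'.
have := g0 c.
case gi: (g c) => [|i]; case gj: (g' c) => [|j] // _; congr _.+1.
have [_ /(_ i gi)[/eqP e hi]] := h3 oc pc.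
have [_ /(_ j gj)[/eqP e' hj]] := h3' oc pc.
case: (ltngtP i j) => // ij.
- by have /eqP := hj _ ij; rewrite -g0 e.
- by have /eqP := hi _ ij; rewrite g0 e'.
Qed.

End Game.

(** * The clopen game of a Delta11 set *)

Section ClopenGame.
Variables (D : set baire) (q : bool -> uformula).
Variable C : bool -> baire -> baire -> Prop.
(** Player [false] argues for [D], player [true] for its complement. *)
Hypothesis DC : forall b x, (D x <-> ~~ b) <-> exists w, C b x w.
Hypothesis qC : forall (b : bool) x a,
  usat (fenv x a) (fun=> 0) (q b) <-> C b x (fun n => a (n + n + b)).

(* Player [b] plays the places of parity [b] of a sequence, aiming at a witness
   for [C b x]; he is alive as long as the approximations do not exclude it. *)
Definition alive (b : bool) (x : baire) (n : nat) (a : baire) : Prop :=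
  uapprox n (fenv x a) (fun=> 0) (q b).

Definition mover_alive x n a : Prop := alive (odd n) x n a.
Definition waiter_alive x n a : Prop := alive (~~ odd n) x n a.

Definition mover_at x c := mover_alive x (size (dec c)) (nth 0 (dec c)).
Definition waiter_at x c := waiter_alive x (size (dec c)) (nth 0 (dec c)).

Definition game x : (nat -> nat) -> Prop :=
  game_value (mover_at x) (waiter_at x).

Lemma alive_ext b x x' n a a' : (forall i, i < n -> x i = x' i) ->
  (forall i, i < n -> a i = a' i) -> alive b x n a -> alive b x' n a'.
Proof.
move=> hx ha; apply: uapprox_ext => -[|j] i /= ni; [exact: hx|exact: ha].
Qed.

(** In an endless play with both players alive, the limit sequence satisfies all approximations of
    both formulas, so its two halves witness that [x] lies in [D] and in its complement. *)
Lemma game_wf x (s : nat -> nat) : (forall n, exists i, s n.+1 = ext (s n) i) ->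
  exists n, ~ (mover_at x (s n) /\ waiter_at x (s n)).
Proof.
move=> hs; apply: contrapT => /forallNP/= h.
have size_s n : size (dec (s n)) = size (dec (s 0)) + n.
  elim: n => [|n IHn]; first by rewrite addn0.
  by have [i ->] := hs n; rewrite dec_ext size_rcons IHn addnS.
have nth_s n k i : i < size (dec (s n)) ->
    nth 0 (dec (s (n + k))) i = nth 0 (dec (s n)) i.
  move=> hi; elim: k => [|k IHk]; first by rewrite addn0.
  rewrite addnS; have [j ->] := hs (n + k).
  rewrite dec_ext nth_rcons ifT ?IHk// size_s.
  by move: hi; rewrite size_s => /leq_trans; apply; rewrite leq_add2l leq_addr.
(* The position [s i.+1] has length at least [i.+1], so its entry [i] is a genuine one. *)
pose a i := nth 0 (dec (s i.+1)) i.
have aE n i : i < size (dec (s n)) -> nth 0 (dec (s n)) i = a i.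
  move=> hi; have [ni|ni] := leqP n i.+1.
    by rewrite /a -(nth_s n (i.+1 - n))// subnKC.
  rewrite /a -(nth_s i.+1 (n - i.+1)) ?subnKC ?(ltnW ni)//.
  by rewrite size_s addnS ltnS leq_addl.
have sat b : exists w, C b x w.
  exists (fun n => a (n + n + b)); apply/qC/uapprox_usat => m.
  apply: (@uapprox_mono _ (size (dec (s m)))); first by rewrite size_s leq_addl.
  have /contrapT[] := h m.
  rewrite /mover_at /waiter_at /mover_alive /waiter_alive => h0 h1.
  apply: (@uapprox_ext _ (fenv x (nth 0 (dec (s m))))) => [[|j] i|].
  - by [].
  - by move=> /aE.
  - by move: h0 h1; case: b; case: odd.
have /DC h0 := sat false; have /DC h1 := sat true.
by have := h0.2 isT; move=> /h1.1.
Qed.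

Lemma game_ex x : exists g, game x g.
Proof. by apply: game_value_ex => s; exact: game_wf. Qed.

Lemma game_unique x g g' : game x g -> game x g' -> g = g'.
Proof. by apply: game_value_unique => s; exact: game_wf. Qed.

(** Each instance of a clause at [c] involves at most two values of [g], and being alive at [c]
    depends on [x] only below the length of [dec c]. A close enough solution thus transfers the
    clause. *)
Lemma game_closed x g :
  (forall N, exists z h, [/\ game z h, forall i, i < N -> z i = x i &
     forall i, i < N -> h i = g i]) -> game x g.
Proof.
move=> hN c.
have localE N b : exists z h, [/\ game z h,
    alive b z (size (dec c)) (nth 0 (dec c)) <->
      alive b x (size (dec c)) (nth 0 (dec c)),
    alive (~~ b) z (size (dec c)) (nth 0 (dec c)) <->
      alive (~~ b) x (size (dec c)) (nth 0 (dec c)) &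
    forall i, i < N -> h i = g i].
  have [z [h [zh zx hg]]] := hN (maxn N (size (dec c))).
  exists z, h; split=> // [||i iN]; last by apply: hg; rewrite leq_max iN.
  - by split; apply: alive_ext => // i iN; rewrite zx// leq_max iN orbT.
  - by split; apply: alive_ext => // i iN; rewrite zx// leq_max iN orbT.
split; [|split].
- move=> nc.
  have [z [h [/(_ c)[zh _] zx _ hg]]] := localE c.+1 (odd (size (dec c))).
  by rewrite -hg// zh// => /zx.
- move=> oc nc.
  have [z [h [/(_ c)[_ [zh _]] zx zx' hg]]] := localE c.+1 (odd (size (dec c))).
  by rewrite -hg// zh//; [exact/zx|move=> /zx'].
- move=> oc pc; split=> [gc i|i gi].
    have [z [h [/(_ c)[_ [_ zh]] zx zx' hg]]] :=
      localE (maxn c (ext c i)).+1 (odd (size (dec c))).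
    have [h0 _] := zh (zx.2 oc) (zx'.2 pc).
    by rewrite -hg ?ltnS ?leq_maxr//; apply: h0; rewrite hg ?ltnS ?leq_maxl.
  split=> [|j ji].
    have [z [h [/(_ c)[_ [_ zh]] zx zx' hg]]] :=
      localE (maxn c (ext c i)).+1 (odd (size (dec c))).
    have [_ h0] := zh (zx.2 oc) (zx'.2 pc).
    rewrite -hg ?ltnS ?leq_maxr//; apply: (h0 _ _).1.
    by rewrite hg ?ltnS ?leq_maxl.
  have [z [h [/(_ c)[_ [_ zh]] zx zx' hg]]] :=
    localE (maxn c (ext c j)).+1 (odd (size (dec c))).
  have [_ h0] := zh (zx.2 oc) (zx'.2 pc).
  rewrite -hg ?ltnS ?leq_maxr//; apply: (h0 i _).2 => //.
  by rewrite hg ?ltnS ?leq_maxl.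
Qed.

(** A player who holds a true witness wins by copying it, since he then never leaves his tree. The
    induction on the outcome refutes every case in which he would lose. *)
Lemma outcome_witness (b : bool) x w c v : C b x w ->
  (forall n, n + n + b < size (dec c) -> nth 0 (dec c) (n + n + b) = w n) ->
  outcome (mover_at x) (waiter_at x) c v ->
  v = (odd (size (dec c)) == b).
Proof.
move=> Cw hw.
have alive_w d : (forall n, n + n + b < size (dec d) ->
    nth 0 (dec d) (n + n + b) = w n) ->
    alive b x (size (dec d)) (nth 0 (dec d)).
  (* Past the end of the position [a] follows [w]: the place [n + n + b] has half [n], and the
     places of the opponent may hold anything. *)
  move=> hd; pose a i := if i < size (dec d) then nth 0 (dec d) i else w i./2.
  apply: (@alive_ext _ x _ _ a) => // [i id|]; first by rewrite /a id.
  apply/usat_uapprox/qC; rewrite (_ : (fun n => _) = w)//; apply/funext => n.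
  rewrite /a; case: ifP => [/hd//|_]; congr w.
  by rewrite addnn addnC half_bit_double.
move=> o; elim: o hw => {c v} [c nc|c oc nc|c i oc pc _ IH|c oc pc _ IH] hw.
- case: eqP => // cb; case: nc.
  by rewrite /mover_at /mover_alive cb; exact: alive_w.
- case: eqP => // cb; case: nc; rewrite /waiter_at /waiter_alive.
  suff -> : ~~ odd (size (dec c)) = b by exact: alive_w.
  by move: cb; case: odd; case: (b).
- case: eqP => // cb; suff : false = (odd (size (dec (ext c i))) == b).
    rewrite dec_ext size_rcons /= => /esym/eqP[].
    by move: cb; case: odd; case: (b).
  apply: IH => n; rewrite dec_ext size_rcons nth_rcons ltnS leq_eqVlt.
  case: ltnP => [/hw//|]; rewrite orbF => _ /eqP e.
  by case: cb; rewrite -e oddD addnn odd_double; case: (b).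
(* Here player [b] is to move at place [n + n + b], and the losing claim is tested on his move
   [w n]. *)
- case: eqP => // cb; have [n hn] : exists n, size (dec c) = n + n + b.
    by exists (size (dec c))./2; rewrite addnn addnC -cb odd_double_half.
  suff : true = (odd (size (dec (ext c (w n)))) == b).
    by rewrite dec_ext size_rcons /= cb; case: (b).
  apply: IH => m; rewrite dec_ext size_rcons nth_rcons ltnS leq_eqVlt.
  case: ltnP => [/hw//|]; rewrite orbF => _ /eqP e.
  rewrite e eqxx; congr w; lia.
Qed.

(** Exactly one player has a witness, and he wins from the empty position, where player [false]
    moves first. *)
Lemma game_start x g : game x g -> (D x <-> g 0 <> 0).
Proof.
move=> xg; have [b hb] : exists b, D x <-> ~~ b.
  by have [h|h] := pselect (D x); [exists false|exists true].
have /DC[w Cw] := hb.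
have [v hv] := outcome_total (game_wf x) 0.
have dec0 : dec 0 = [::] by apply: dec_root.
have vE : v = ~~ b.
  rewrite (outcome_witness Cw _ hv) dec0; first by case: (b).
  by [].
rewrite hb -vE -(negbK v) -(game_value_outcome xg hv).
by split=> /eqP.
Qed.

(* A function [y] codes [dec], pinned down by its recursion equations, and a
   value function; the rules of the game are then arithmetical in [x] and
   [y]. *)
Let len (y : baire) d := y (qpair 0 d).
Let entry (y : baire) d n := y (qpair 1 (qpair d n)).
Let value (y : baire) d := y (qpair 2 d).

Let decoder (y : baire) : Prop :=
  (forall c i, len y (ext c i) = (len y c).+1 /\
    forall n, (n < len y c -> entry y (ext c i) n = entry y c n) /\
      (n = len y c -> entry y (ext c i) n = i) /\
      (len y c < n -> entry y (ext c i) n = 0)) /\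
  (forall d, (forall c i, d <> ext c i) ->
    len y d = 0 /\ forall n, entry y d n = 0).

(** Strong induction along [c < ext c i]. The clauses that put zeros past the length match the
    default of [nth 0], so the whole function [entry y d] is determined. *)
Let decoderP y : decoder y <->
  forall d, len y d = size (dec d) /\ entry y d = nth 0 (dec d).
Proof.
split=> [[h1 h2] d|h]; last first.
  split=> [c i|d /dec_root hd]; last first.
    have [-> ->] := h d; rewrite hd; split=> // n; exact: nth_nil.
  have [-> ->] := h c; have [-> ->] := h (ext c i).
  rewrite dec_ext size_rcons; split=> // n; rewrite nth_rcons.
  split=> [->//|]; split=> [->|nc]; first by rewrite ltnn eqxx.
  by rewrite ltnNge (ltnW nc) /= eq_sym (ltn_eqF nc).
elim/ltn_ind: d => d IHd.
have [[[c i] /= dE]|nd] := pselect (exists ci, d = ext ci.1 ci.2); last first.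
  have hd : forall c i, d <> ext c i by move=> c i e; apply: nd; exists (c, i).
  have [-> hn] := h2 d hd; rewrite dec_root//; split=> //.
  by apply/funext => n; rewrite hn nth_nil.
have [lc ec] : len y c = size (dec c) /\ entry y c = nth 0 (dec c).
  by apply: IHd; rewrite dE ltnS qpair_geL.
have [le ee] := h1 c i.
rewrite dE le lc dec_ext size_rcons; split=> //; apply/funext => n.
rewrite nth_rcons; have := ee n; rewrite lc ec => -[e1 [e2 e3]].
by case: ltngtP => [/e1|/e3|/e2].
Qed.

Let encode g : exists y, decoder y /\ value y = g.
Proof.
have [en hen] := qpair_uncurry (fun d n => nth 0 (dec d) n).
have [y hy] := qpair_uncurry (fun k =>
  if k is k'.+1 then if k' is _.+1 then g else en
  else fun d => size (dec d)).
exists y; split; last by apply/funext => d; rewrite /value hy.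
apply/decoderP => d; split; first by rewrite /len hy.
by apply/funext => n; rewrite /entry hy hen.
Qed.

Let game_at x (y : baire) : Prop :=
  game_value (fun c => mover_alive x (len y c) (entry y c))
             (fun c => waiter_alive x (len y c) (entry y c)) (value y).

Let game_atP x y : decoder y -> game_at x y <-> game x (value y).
Proof.
move=> /decoderP hy; rewrite /game_at /game /mover_at /waiter_at.
have -> : len y = (fun c => size (dec c)) by apply/funext => d; have [] := hy d.
suff -> : entry y = (fun c => nth 0 (dec c)) by [].
by apply/funext => d; have [] := hy d.
Qed.

(** The mover is the case [neg = false], the waiter [neg = true]. The index of [q] is a boolean
    outside the language, so the parity of the length selects between two fixed formulas. *)
Let d_mover_alive (neg : bool) :
  definable (fun f e => alive (neg (+) odd (len (f 1) (e 0))) (f 0)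
    (len (f 1) (e 0)) (entry (f 1) (e 0))).
Proof.
have dl : definable_term (fun f e => len (f 1) (e 0)).
  by apply/dt_app/dt_pair; [exact: dt_const|exact: dt_var].
have dS : definable_subst
    (fun f e => fenv (f 0) (entry (f 1) (e 0))) (fun _ _ _ => 0).
  split=> [[|j]|i] /=; last exact: dt_const; first exact/dt_app/dt_var.
  by apply/dt_app/dt_pair; [exact: dt_const|apply: dt_pair; exact: dt_var].
have dA b := d_uapprox (q b) dl dS.
pose alive_at b (f : nat -> baire) (e : nat -> nat) :=
  alive b (f 0) (len (f 1) (e 0)) (entry (f 1) (e 0)).
apply: (@d_ext (fun f e => (odd (len (f 1) (e 0)) -> alive_at (~~ neg) f e) /\
  (~ odd (len (f 1) (e 0)) -> alive_at neg f e))); rewrite /alive_at.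
  move=> f e; case: odd; rewrite ?addbT ?addbF; split=> [[h h']|h].
  - exact: h.
  - by split.
  - exact: h'.
  - by split.
apply: d_and; apply: d_imp; rewrite ?/alive //; first exact: d_odd.
by apply: d_not; exact: d_odd.
Qed.

Ltac definability := repeat first
  [ apply: dt_var | apply: dt_const | apply: dt_app | apply: dt_pair
  | apply: dt_succ | apply: d_lt | apply: d_eq | apply: d_not
  | apply: d_and | apply: d_imp ].

Let d_decoder : definable (fun f _ => decoder (f 1)).
Proof.
rewrite /decoder /len /entry /ext.
apply: d_and.
  apply: (@d_all (fun c f e => forall i, _)).
  apply: (@d_all (fun i f e => _ /\ forall n, _)).
  apply: d_and; first by definability.
  apply: (@d_all (fun n f e => _ /\ _)).
  by definability.
apply: (@d_all (fun d f e => _ -> _)).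
apply: d_imp.
  apply: (@d_all (fun c f e => forall i, _)).
  apply: (@d_all (fun i f e => ~ _)).
  by definability.
apply: d_and; first by definability.
apply: (@d_all (fun n f e => _ = _)).
by definability.
Qed.

Let d_game_at : definable (fun f _ => game_at (f 0) (f 1)).
Proof.
rewrite /game_at /game_value.
apply: (@d_all (fun c f e => _ /\ _)).
have dm := d_mover_alive false; have dw := d_mover_alive true.
apply: d_and.
  by apply: d_imp; [exact: d_not|definability].
apply: d_and.
  by apply: d_imp => //; apply: d_imp; [exact: d_not|definability].
apply: d_imp => //; apply: d_imp => //; rewrite /value /ext; apply: d_and.
  apply: d_imp; first by definability.
  by apply: (@d_all (fun i f e => ~ _)); definability.
apply: (@d_all (fun i f e => _ -> _)).
apply: d_imp; first by definability.
apply: d_and; first by definability.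
by apply: (@d_all (fun j f e => _ -> _)); definability.
Qed.

(** Every [x] has a code [y] obeying the rules, and all such [y] have the same value function [G x].
    Hence both the set and its complement can be defined by an existential quantifier over [y]. *)
Lemma Delta11_game (G : baire -> baire) n k : (forall x, game x (G x)) ->
  Delta11 [set x | G x n = k].
Proof.
move=> hG.
have GE x y : decoder y -> game_at x y -> value y = G x.
  by move=> dy /(game_atP x dy)/game_unique; apply.
have yG x : exists y, [/\ decoder y, game_at x y & value y = G x].
  have [y [dy vy]] := encode (G x); exists y; split=> //.
  by apply/(game_atP x dy); rewrite vy.
have dv : definable (fun f _ => value (f 1) n = k).
  by rewrite /value; definability.
split.
  rewrite (_ : [set x | _] =
      [set x | exists y, decoder y /\ game_at x y /\ value y n = k]).
    by apply: Sigma11_definable; apply: d_and => //; apply: d_and.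
  apply/seteqP; split=> x /= [].
    by have [y [dy gy <-]] := yG x; exists y.
  by move=> y [dy [gy]]; rewrite (GE x).
rewrite /Pi11 (_ : ~` [set x | _] =
    [set x | exists y, decoder y /\ game_at x y /\ ~ value y n = k]).
  apply: Sigma11_definable; apply: d_and => //; apply: d_and => //.
  exact: d_not.
apply/seteqP; split=> x /=.
  by have [y [dy gy <-]] := yG x; exists y.
by move=> [y [dy [gy]]]; rewrite (GE x).
Qed.

End ClopenGame.

Lemma Delta11_closed_graph D : Delta11 D -> exists G : baire -> baire,
  [/\ forall n k, Delta11 [set x | G x n = k],
      D = [set x | G x 0 <> 0] &
      forall x g, (forall N, exists z, forall i, i < N ->
         z i = x i /\ G z i = g i) -> G x = g].
Proof.
move=> [/(Sigma11_closed 0)[q0 [C0 [D0 h0]]]].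
move=> /(Sigma11_closed 1)[q1 [C1 [D1 h1]]].
pose q b := if b then q1 else q0.
pose C b := if b then C1 else C0.
have DC b x : (D x <-> ~~ b) <-> exists w, C b x w.
  case: b => /=.
    rewrite -[exists w, _]/([set x | exists w, C1 x w] x) -D1.
    by split=> [h /h|h].
  rewrite -[exists w, _]/([set x | exists w, C0 x w] x) -D0.
  by split=> [h|h]; [exact/h|].
have qC (b : bool) x a :
    usat (fenv x a) (fun=> 0) (q b) <-> C b x (fun n => a (n + n + b)).
  by case: b; [exact: h1|exact: h0].
have /choice[G hG] := game_ex DC qC.
exists G; split.
- by move=> n k; exact: (Delta11_game DC qC).
- by apply/seteqP; split=> x /(game_start DC qC (hG x)).
- move=> x g hN; apply: (game_unique DC qC (hG x)).
  apply: game_closed => N; have [z hz] := hN N.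
  by exists z, (G z); split=> // i /hz[].
Qed.

(** * Countability of the Sigma11 sets *)

Fixpoint aterm_code (t : aterm) : nat :=
  match t with
  | AVar i => qpair 0 i
  | AZero => qpair 1 0
  | ASucc t => qpair 2 (aterm_code t)
  | AAdd t u => qpair 3 (qpair (aterm_code t) (aterm_code u))
  | AMul t u => qpair 4 (qpair (aterm_code t) (aterm_code u))
  | AApp j t => qpair 5 (qpair j (aterm_code t))
  end.

Lemma aterm_code_inj : injective aterm_code.
Proof.
elim=> [i||t IHt|t IHt u IHu|t IHt u IHu|j t IHt];
  case=> [i'||t'|t' u'|t' u'|j' t'] /= /qpair_inj[] // _.
- by move=> ->.
- by move=> /IHt ->.
- by move=> /qpair_inj[/IHt -> /IHu ->].
- by move=> /qpair_inj[/IHt -> /IHu ->].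
- by move=> /qpair_inj[-> /IHt ->].
Qed.

Fixpoint aformula_code (p : aformula) : nat :=
  match p with
  | AEq t u => qpair 0 (qpair (aterm_code t) (aterm_code u))
  | ANot p => qpair 1 (aformula_code p)
  | AAnd p q => qpair 2 (qpair (aformula_code p) (aformula_code q))
  | AAll p => qpair 3 (aformula_code p)
  end.

Lemma aformula_code_inj : injective aformula_code.
Proof.
elim=> [t u|p IHp|p IHp q IHq|p IHp]; case=> [t' u'|p'|p' q'|p'] /=
  /qpair_inj[] // _.
- by move=> /qpair_inj[/aterm_code_inj -> /aterm_code_inj ->].
- by move=> /IHp ->.
- by move=> /qpair_inj[/IHp -> /IHq ->].
- by move=> /IHp ->.
Qed.

Lemma Sigma11_enumeration (S : set (set baire)) : S setT -> S `<=` Sigma11 ->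
  exists en : nat -> set baire,
    (forall n, S (en n)) /\ (forall A, S A -> exists n, A = en n).
Proof.
move=> ST SS.
pose en0 n : set baire :=
  [set x | exists2 p, aformula_code p = n & exists y, arith p x y].
have en0P A : S A -> exists n, A = en0 n.
  move=> /SS[p Ap]; exists (aformula_code p); rewrite Ap; apply/seteqP.
  by split=> x /= [y]; [exists p => //; exists y|move/aformula_code_inj => ->].
(* Indices whose set falls outside [S] receive the default [setT]. *)
exists (fun n => if pselect (S (en0 n)) then en0 n else setT); split=> [n|A SA].
  by case: pselect.
by have [n An] := en0P A SA; exists n; case: pselect => //; rewrite -An.
Qed.

(** * Closed embeddings in countable powers of the natural numbers *)

Section PolishEmbedding.
Variables (R : realType) (T : topologicalType) (I : countType).
Variables (psi : T -> I -> nat) (x0 : T).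
Hypothesis psi_inj : injective psi.
(** Together these hypotheses make [psi] a homeomorphism onto a closed subset of [I -> nat], the
    product of discrete spaces. *)
Hypothesis psi_open : forall x i, open [set y | psi y i = psi x i].
Hypothesis psi_base : forall (A : set T) x, open A -> A x ->
  exists s : seq I, forall y, (forall i, i \in s -> psi y i = psi x i) -> A y.
Hypothesis psi_closed : forall u : I -> nat,
  (forall s : seq I, exists z, forall i, i \in s -> psi z i = u i) ->
  exists x, psi x = u.

Let agree (x y : T) (n : nat) : Prop :=
  forall i : I, pickle i < n -> psi x i = psi y i.

Let agreeC x y : agree x y = agree y x.
Proof.
by apply/funext => n; apply/propext; split=> h i /h.
Qed.

Let agree_mono x y m n : m <= n -> agree x y n -> agree x y m.
Proof. by move=> mn h i im; apply: h; exact: leq_trans mn. Qed.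

Let agree_seq x y (s : seq I) :
  agree x y (\max_(i <- s) (pickle i).+1) ->
  forall i, i \in s -> psi x i = psi y i.
Proof.
move=> h i si; apply: h.
by rewrite (big_rem i)//= leq_max leqnn.
Qed.

Let below (n : nat) : seq I := pmap (@unpickle I) (iota 0 n).

Let mem_below n i : pickle i < n -> i \in below n.
Proof.
move=> ni; rewrite mem_pmap; apply/mapP.
by exists (pickle i); rewrite ?pickleK ?mem_iota.
Qed.

Let open_agree x n : open [set y | agree y x n].
Proof.
suff h (s : seq I) : open [set y | forall i, i \in s -> psi y i = psi x i].
  (* The filter is there because [unpickle] may send a number to an index with a different code. *)
  rewrite (_ : [set y | _] =
    [set y | forall i, i \in [seq i <- below n | pickle i < n] ->
      psi y i = psi x i]).
    exact: h.
  apply/seteqP; split=> y /= hy i.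
    by rewrite mem_filter => /andP[/hy].
  by move=> ni; apply: hy; rewrite mem_filter ni mem_below.
elim: s => [|i s IHs].
  rewrite (_ : [set y | _] = setT); first exact: openT.
  by apply/seteqP; split.
rewrite (_ : [set y | _] =
  [set y | psi y i = psi x i] `&`
  [set y | forall i, i \in s -> psi y i = psi x i]).
  exact: openI.
apply/seteqP; split=> y /= => [h|[h h'] j].
  by split=> [|j js]; apply: h; rewrite inE ?eqxx ?js ?orbT.
by rewrite inE => /predU1P[->//|/h'].
Qed.

Local Open Scope ring_scope.

(** The first-difference ultrametric: the distance is the inverse of [k + 1], where [k] is the least
    code of a coordinate at which the points differ. The minimum is positive, as [agree x y 0] is
    vacuous. *)
Definition psi_dist (x y : T) : R :=
  if pselect (exists n, `[< ~ agree x y n >]) is left h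
  then (ex_minn h)%:R^-1 else 0.

Lemma psi_distP x y n : psi_dist x y < n.+1%:R^-1 <-> agree x y n.+1.
Proof.
rewrite /psi_dist; case: pselect => [h|h].
  case: ex_minnP => m /asboolP hm mm.
  have m0 : (0 < m)%N by case: m hm {mm} => // -[].
  rewrite ltf_pV2 ?posrE ?ltr0n// ltr_nat; split=> [nm|hn].
    apply: contrapT => /asboolP/mm; by rewrite leqNgt nm.
  by rewrite ltnNge; apply/negP => mn; apply: hm; exact: agree_mono hn.
split=> [_|_]; last by rewrite invr_gt0 ltr0n.
by apply: contrapT => hn; apply: h; exists n.+1; apply/asboolP.
Qed.

Lemma psi_dist_values x y :
  psi_dist x y = 0 \/ exists n, psi_dist x y = n.+1%:R^-1.
Proof.
rewrite /psi_dist; case: pselect => [h|h]; last by left.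
right; case: ex_minnP => -[|m] /asboolP hm mm; last by exists m.
by case: hm.
Qed.

Lemma psi_dist_ge0 x y : 0 <= psi_dist x y.
Proof. by have [->|[n ->]] := psi_dist_values x y; rewrite ?invr_ge0. Qed.

Lemma small_inv (e : R) : 0 < e -> exists n : nat, n.+1%:R^-1 < e.
Proof.
move=> e0; exists (Num.truncn e^-1).
rewrite invf_plt ?posrE// ?ltr0n//.
exact: truncnS_gt.
Qed.

Lemma psi_dist_small (e : R) : 0 < e -> exists n : nat,
  forall x y, agree x y n.+1 -> psi_dist x y < e.
Proof.
move=> /small_inv[n ne]; exists n => u v /psi_distP h; exact: lt_trans ne.
Qed.

Lemma psi_dist_metric : is_metric psi_dist.
Proof.
split.
- exact: psi_dist_ge0.
- move=> x y; split=> [xy|->]; last first.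
    have [//|[n]] := psi_dist_values y y.
    have : psi_dist y y < n.+1%:R^-1 by apply/psi_distP.
    by move=> /[swap] ->; rewrite ltxx.
  apply/psi_inj/funext => i; have : agree x y (pickle i).+1.
    by apply/psi_distP; rewrite xy invr_gt0 ltr0n.
  exact.
- by move=> x y; rewrite /psi_dist agreeC.
- move=> x y z; have [->|[n xz]] := psi_dist_values x z.
    by rewrite addr_ge0// psi_dist_ge0.
  (* The ultrametric inequality: where [x] and [z] differ, one of them differs from [y]. *)
  have : ~ (agree x y n.+1 /\ agree y z n.+1).
    move=> [xy yz]; have : psi_dist x z < n.+1%:R^-1.
      by apply/psi_distP => i ni; rewrite xy// yz.
    by rewrite xz ltxx.
  move=> /not_andP[] h; rewrite xz.
    rewrite ler_wpDr ?psi_dist_ge0// leNgt; apply/negP => /psi_distP; exact: h.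
  rewrite ler_wpDl ?psi_dist_ge0// leNgt; apply/negP => /psi_distP; exact: h.
Qed.

Lemma psi_dist_induces : metric_induces psi_dist.
Proof.
move=> A; split=> [oA x Ax|hA].
  have [s hs] := psi_base oA Ax.
  exists (\max_(i <- s) (pickle i).+1).+1%:R^-1.
    by rewrite invr_gt0 ltr0n.
  move=> y /= /psi_distP; rewrite agreeC => /(agree_mono (leqnSn _)) h.
  exact/hs/agree_seq.
rewrite openE => x /hA[e e0 he].
have [n hn] := psi_dist_small e0.
rewrite /interior nbhsE; exists [set y | agree y x n.+1] => [|y].
  by split=> //; exact: open_agree.
by rewrite /= agreeC => /hn/he.
Qed.

Lemma psi_dist_complete : metric_complete psi_dist.
Proof.
move=> u hu.
have /choice[N hN] (k : nat) : exists N, forall m n, (N <= m)%N -> (N <= n)%N ->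
    agree (u m) (u n) k.+1.
  have [|N hN] := hu k.+1%:R^-1; first by rewrite invr_gt0 ltr0n.
  by exists N => m n Nm Nn; apply/psi_distP; exact: hN.
(* The coordinate [i] is constant along [u] from the stage [N (pickle i)] on. *)
pose lim (i : I) := psi (u (N (pickle i))) i.
have limE k n (i : I) : (N k <= n)%N -> (pickle i < k.+1)%N ->
    psi (u n) i = lim i.
  move=> Nn ik; pose m := maxn n (N (pickle i)).
  rewrite (hN k n m)// ?leq_max ?Nn//.
  by rewrite (hN (pickle i) m (N (pickle i)))// leq_maxr.
have [l hl] : exists l, psi l = lim.
  apply: psi_closed => s; pose k := \max_(i <- s) (pickle i).+1.
  exists (u (N k)) => i si; apply: limE => //.
  by rewrite ltnS /k (big_rem i)//= leq_max ltnW.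
exists l => e /psi_dist_small[k hk]; exists (N k) => n Nn.
by apply: hk => i ik; rewrite hl; exact: limE ik.
Qed.

(** There are countably many finite patterns of prescribed coordinates; one point is chosen for each
    pattern that is realized, and [x0] for the others. *)
Lemma psi_separable : separable T.
Proof.
have /choice[h hh] (s : seq (I * nat)) : exists z, forall x,
    (forall p, p \in s -> psi x p.1 = p.2) ->
    forall p, p \in s -> psi z p.1 = p.2.
  have [[x hx]|nx] := pselect (exists x, forall p, p \in s -> psi x p.1 = p.2).
    by exists x.
  by exists x0 => x hx; case: nx; exists x.
exists (range h); first exact: sub_countable (card_image_le _ _) (countableP _).
move=> O [x Ox] oO; have [s hs] := psi_base oO Ox.
pose t := [seq (i, psi x i) | i <- s].
exists (h t); split; last by exists t.
apply: hs => i si; apply: (hh _ x _ (i, psi x i)); last by apply/mapP; exists i.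
by move=> p /mapP[j _ ->].
Qed.

Lemma polish_embedding : polish R T.
Proof.
split; first exact: psi_separable.
exists psi_dist; split.
- exact: psi_dist_metric.
- exact: psi_dist_induces.
- exact: psi_dist_complete.
Qed.

End PolishEmbedding.

(** * The two topologies *)

Lemma delta_open_base (A : set delta_baire) x : open A -> A x ->
  exists B, [/\ Delta11 B, B x & B `<=` A].
Proof.
move=> [S sS <-] [B SB Bx]; exists B; split=> //; first exact: sS.
by move=> y By; exists B.
Qed.

Lemma delta_open (A : set delta_baire) : Delta11 A -> open A.
Proof.
move=> dA; exists [set A]; first by move=> B ->.
by rewrite bigcup_set1.
Qed.

Lemma sigma_delta_open_base (A : set sigma_delta_baire) x : open A -> A x ->
  exists B, [/\ SigmaDelta B, B x & B `<=` A].
Proof.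
move=> [S sS <-] [B SB Bx]; exists B; split=> //; first exact: sS.
by move=> y By; exists B.
Qed.

Lemma sigma_delta_open (A : set sigma_delta_baire) : SigmaDelta A -> open A.
Proof.
move=> dA; exists [set A]; first by move=> B ->.
by rewrite bigcup_set1.
Qed.

Lemma Delta11C A : Delta11 A -> Delta11 (~` A).
Proof. by move=> [sA pA]; split=> //; rewrite /Pi11 setCK. Qed.

Lemma delta_closed (A : set delta_baire) : Delta11 A -> closed A.
Proof. by move=> /Delta11C/delta_open/open_closedC; rewrite setCK. Qed.

Lemma Delta11_SigmaDelta A : Delta11 A -> SigmaDelta A.
Proof. by move=> dA; split; [have [] := dA|exact: delta_closed]. Qed.

Lemma Delta11_digit n k : Delta11 [set x | x n = k].
Proof.
split.
  rewrite (_ : [set x | _] = [set x | exists y : baire, x n = k]).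
    apply: (@Sigma11_definable (fun x y => x n = k)).
    by apply: d_eq; [apply/dt_app|]; exact: dt_const.
  by apply/seteqP; split=> x /= => [h|[]//]; exists x.
rewrite /Pi11 (_ : ~` [set x | _] = [set x | exists y : baire, x n <> k]).
  apply: (@Sigma11_definable (fun x y => x n <> k)).
  by apply/d_not/d_eq; [apply/dt_app|]; exact: dt_const.
by apply/seteqP; split=> x /= => [h|[]//]; exists x.
Qed.

(** The digits of [x] give injectivity and let a limit point be read off; the coordinate [(k, 0)]
    decides membership in the [k]-th Delta11 set. The image is closed because each game function has
    a closed graph. *)
Lemma delta_coordinates :
  exists psi : delta_baire -> (nat + nat * nat)%type -> nat,
  [/\ injective psi,
      forall i k, Delta11 [set x | psi x i = k],
      forall A x, open A -> A x -> exists s : seq (nat + nat * nat), forall y,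
        (forall i, i \in s -> psi y i = psi x i) -> A y &
      forall u, (forall s : seq (nat + nat * nat), exists z,
          forall i, i \in s -> psi z i = u i) -> exists x, psi x = u].
Proof.
have [en [Den enD]] := Sigma11_enumeration Delta11T (fun A dA => dA.1).
have /choice[G hG] k := Delta11_closed_graph (Den k).
pose psi (x : delta_baire) (i : nat + nat * nat) :=
  match i with inl n => x n | inr (k, n) => G k x n end.
exists psi; split.
- by move=> x y xy; apply/funext => n; have := congr1 (fun f => f (inl n)) xy.
- move=> [n|[k n]] m /=; first exact: Delta11_digit.
  by have [h _ _] := hG k; exact: h.
- move=> A x oA Ax; have [B [dB Bx BA]] := delta_open_base oA Ax.
  have [k Bk] := enD B dB; have [_ ek _] := hG k.
  exists [:: inr (k, 0)] => y hy; apply: BA; rewrite Bk ek /=.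
  have := hy (inr (k, 0)); rewrite mem_seq1 eqxx => /(_ isT) /= ->.
  by move: Bx; rewrite Bk ek.
- move=> u hu; exists (fun n => u (inl n)); apply/funext => -[n//|[k n]] /=.
  have [_ _ gk] := hG k.
  rewrite (gk _ (fun n => u (inr (k, n))))// => N.
  have [z hz] := hu ([seq inl i | i <- iota 0 N] ++
    [seq inr (k, i) | i <- iota 0 N]).
  exists z => i iN; split.
    apply: (hz (inl i)); rewrite mem_cat; apply/orP; left; apply/mapP.
    by exists i => //; rewrite mem_iota.
  apply: (hz (inr (k, i))); rewrite mem_cat; apply/orP; right; apply/mapP.
  by exists i => //; rewrite mem_iota.
Qed.

(** The fibre over 0 is [A] itself, and every other fibre is a finite Boolean combination of Delta11
    sets. *)
Lemma SigmaDelta_index A : SigmaDelta A -> exists f : baire -> nat,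
  A = [set x | f x = 0] /\ forall k, SigmaDelta [set x | f x = k].
Proof.
move=> [sA cA].
have [en [Den enD]] := Sigma11_enumeration Delta11T (fun A dA => dA.1).
pose out n x := en n x /\ en n `<=` ~` A.
(* Closedness of [A] in the Delta-topology enters here. *)
have outP x : ~ A x -> exists n, `[< out n x >].
  move=> nAx; have [B [dB Bx BA]] := delta_open_base (closed_openC cA) nAx.
  by have [n Bn] := enD B dB; exists n; apply/asboolP; split; rewrite -Bn.
pose f x := if pselect (A x) is right nAx then (ex_minn (outP x nAx)).+1 else 0.
have f0 : A = [set x | f x = 0].
  by apply/seteqP; split=> x; rewrite /f /=; case: pselect.
exists f; split=> // -[|k]; first by rewrite -f0.
have fS : [set x | f x = k.+1] =
    [set x | out k x] `&` [set x | forall j, j < k -> ~ out j x].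
  apply/seteqP; split=> x; rewrite /f /=; case: pselect => // nAx.
  - case: ex_minnP => n /asboolP hn mn [<-]; split=> // j jn /asboolP/mn.
    by rewrite leqNgt jn.
  - by move=> [[Bx BA] _]; have := BA x Bx.
  - case: ex_minnP => n /asboolP hn mn [hk hj]; congr _.+1.
    apply/eqP; rewrite eqn_leq mn; last exact/asboolP.
    by rewrite leqNgt; apply/negP => /hj.
(* The inclusion in the complement of [A] does not involve [x], so the set is [en n] or empty. *)
have dout n : Delta11 [set x | out n x].
  have [h|h] := pselect (en n `<=` ~` A).
    rewrite (_ : [set x | _] = en n); first exact: Den.
    by apply/seteqP; split=> x => [[]|].
  rewrite (_ : [set x | _] = ~` setT); first exact/Delta11C/Delta11T.
  by apply/seteqP; split=> x => [[_ /h]|/(_ I)].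
apply: Delta11_SigmaDelta; rewrite fS; apply: Delta11I => //.
elim: k {fS} => [|k IHk].
  rewrite (_ : [set x | _] = setT); first exact: Delta11T.
  by apply/seteqP; split=> // x _ j; rewrite ltn0.
rewrite (_ : [set x | _] =
  [set x | forall j, j < k -> ~ out j x] `&` ~` [set x | out k x]).
  by apply: Delta11I => //; exact: Delta11C.
apply/seteqP; split=> x /=.
  by move=> h; split=> [j jk|]; [exact: h j (ltnW jk)|exact: h k (ltnSn k)].
by move=> [h h'] j; rewrite ltnS leq_eqVlt => /predU1P[->|/h].
Qed.

Theorem theorem1p3 (R : realType) :
  polish R delta_baire /\ polish R sigma_delta_baire.
Proof.
have [psi [psi_inj psi_D psi_base psi_closed]] := delta_coordinates.
split.
  apply: (polish_embedding R point psi_inj) => // x i.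
  exact/delta_open/psi_D.
have ST : SigmaDelta setT by exact/Delta11_SigmaDelta/Delta11T.
have [en [Sen enS]] := Sigma11_enumeration ST (fun A sA => sA.1).
have /choice[f hf] k := SigmaDelta_index (Sen k).
(* Adding the functions [f k] makes the sets [en k] open; the image stays closed
   because the fibres of [f k] are closed in the Delta-topology. *)
pose phi (x : sigma_delta_baire) (i : (nat + nat * nat) + nat) :=
  match i with inl i => psi x i | inr k => f k x end.
have phi_SD i k : SigmaDelta [set x | phi x i = k].
  case: i => [i|n]; first exact/Delta11_SigmaDelta/psi_D.
  by have [_] := hf n; exact.
apply: (@polish_embedding R _ _ phi point).
- move=> x y xy; apply: psi_inj; apply/funext => i.
  by have := congr1 (fun g => g (inl i)) xy.
- by move=> x i; exact: sigma_delta_open.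
- move=> A x oA Ax; have [B [sB Bx BA]] := sigma_delta_open_base oA Ax.
  have [k Bk] := enS B sB; have [fk _] := hf k.
  exists [:: inr k] => y hy; apply: BA; rewrite Bk fk /=.
  have := hy (inr k); rewrite mem_seq1 eqxx => /(_ isT) /= ->.
  by move: Bx; rewrite Bk fk.
- move=> u hu.
  have [s|x hx] := psi_closed (fun i => u (inl i)).
    have [z hz] := hu [seq inl i | i <- s].
    by exists z => i si; apply: (hz (inl i)); apply/mapP; exists i.
  exists x; apply/funext => -[i|k] /=; first by rewrite hx.
  (* Otherwise finitely many coordinates of [psi x] would already force [f k] to differ from
     [u (inr k)], yet some [z] matches [u] on these coordinates and on [inr k]. *)
  apply: contrapT => fx.
  have [_ /(_ (u (inr k)))[_ cf]] := hf k.
  have [s hs] := psi_base _ x (closed_openC cf) fx.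
  have [z hz] := hu (inr k :: [seq inl i | i <- s]).
  case: (hs z) => [i si|]; last by apply: (hz (inr k)); rewrite inE eqxx.
  rewrite hx; apply: (hz (inl i)); rewrite inE; apply/orP; right.
  by apply/mapP; exists i.
Qed.
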